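(* For any polynomial $p:\mathbb{C}\to\mathbb{C}$, let $P:\mathbb{C}\to\mathbb{C}$ be the unique polynomial with $P(0)=0$ and $P(z)-P(z-1)=p(z)$ for all $z\in\mathbb{C}$. Consider the formula $$( * )\qquad \sum_{\nu=x}^{y} p(\nu)=P(y)-P(x-1).$$ Then: 1. If $( * )$ is used as a definition of $\sum_{\nu=x}^y p(\nu)$ for all polynomials $p$ and all $x,y\in\mathbb{C}$, then all the axioms (S1), (S2), (S3), (S4), (S5) and right shift continuity (S6) are satisfied for the case that the summed functions are polynomials. 2. Conversely, every summation theory that satisfies axioms (S1), (S2), (S3) and (S4) also satisfies $( * )$ for every polynomial $p$ and all $x,y\in\mathbb{C}$ with rational difference $y-x\in\mathbb{Q}$. 3. Every summation theory that satisfies (S1), (S2), (S3), (S4) and (S5) also satisfies $( * )$ for every polynomial $p$ and all $x,y\in\mathbb{C}$.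
   Context: Polynomials are polynomials in one variable with complex coefficients, viewed as functions $\mathbb{C}\to\mathbb{C}$, and $\mathbb{N}=\{0,1,2,\dots\}$. A summation theory is an assignment, to all $x,y\in\mathbb{C}$ and all polynomials $f$ (possibly also to further functions), of a complex number denoted $\sum_{\nu=x}^y f(\nu)$. For functions $f,g$ being summed (here: polynomials), the axioms are: (S1) Continued summation: $\sum_{\nu=x}^y f(\nu)+\sum_{\nu=y+1}^z f(\nu)=\sum_{\nu=x}^z f(\nu)$ for all $x,y,z\in\mathbb{C}$. (S2) Translation invariance: $\sum_{\nu=x+s}^{y+s} f(\nu)=\sum_{\nu=x}^y f(\nu+s)$ for all $x,y,s\in\mathbb{C}$, the right-hand side being the sum of the function $\nu\mapsto f(\nu+s)$. (S3) Linearity: for all constants $\lambda,\mu\in\mathbb{C}$ and all $x,y\in\mathbb{C}$, $\sum_{\nu=x}^y(\lambda f(\nu)+\mu g(\nu))=\lambda\sum_{\nu=x}^y f(\nu)+\mu\sum_{\nu=x}^y g(\nu)$. (S4) Consistency with the classical definition: $\sum_{\nu=1}^1 f(\nu)=f(1)$. (S5) Monomials: for every $d\in\mathbb{N}$, the map $z\mapsto\sum_{\nu=1}^z\nu^d$ is holomorphic in $\mathbb{C}$. (S6) Right shift continuity: if $\lim_{n\to+\infty}f(z+n)=0$ for every $z\in\mathbb{C}$, then $\lim_{n\to+\infty}\sum_{\nu=x}^y f(\nu+n)=0$ for all $x,y\in\mathbb{C}$; more generally, if there is a sequence of polynomials $(p_n)_{n\in\mathbb{N}}$ of fixed degree such that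 $|f(z+n)-p_n(z+n)|\to 0$ as $n\to+\infty$ for all $z\in\mathbb{C}$, then $\left|\sum_{\nu=x}^y f(\nu+n)-\sum_{\nu=x}^y p_n(\nu+n)\right|\to 0$ as $n\to+\infty$ for all $x,y\in\mathbb{C}$. *)

(* Defs.v *)
From HB Require Import structures.
From mathcomp Require Import all_boot all_order all_algebra.
From mathcomp Require Import all_classical all_reals all_analysis.
From mathcomp Require Import complex.
Set Implicit Arguments.
Unset Strict Implicit.
Unset Printing Implicit Defensive.
Import Order.TTheory GRing.Theory Num.Theory.
Import numFieldNormedType.Exports.
Local Open Scope classical_set_scope.
Local Open Scope ring_scope.

(* The complex numbers are bundled as a [numClosedFieldType] because the
   topology and the norm of MathComp-Analysis are inferred from that
   structure, not from the bare type [R[i]]. *)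
Definition CC (R : realType) : numClosedFieldType := R[i].

(* [S x y f] stands for $\sum_{\nu=x}^y f(\nu)$. A summation theory is defined
   on the polynomial functions and possibly on others: [S] is total, but the
   axioms below only constrain its values at polynomial functions. *)
Definition summation (R : realType) : Type :=
  CC R -> CC R -> (CC R -> CC R) -> CC R.

Section SummationTheory.
Context {R : realType}.
Local Notation C := (CC R).
Implicit Types (S : summation R) (f g p P : {poly C}).

Definition continued_summation S : Prop :=
  forall f (x y z : C),
    S x y (fun nu => f.[nu]) + S (y + 1) z (fun nu => f.[nu])
    = S x z (fun nu => f.[nu]).

Definition translation_invariance S : Prop :=
  forall f (x y s : C),
    S (x + s) (y + s) (fun nu => f.[nu]) = S x y (fun nu => f.[nu + s]).

Definition sum_linearity S : Prop :=
  forall f g (lambda mu x y : C),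
    S x y (fun nu => lambda * f.[nu] + mu * g.[nu])
    = lambda * S x y (fun nu => f.[nu]) + mu * S x y (fun nu => g.[nu]).

Definition classical_consistency S : Prop :=
  forall f, S 1 1 (fun nu => f.[nu]) = f.[1].

(* The scalars are [C] itself, so this is complex differentiability. *)
Definition entire (h : C -> C) : Prop :=
  forall z : C, derivable (h : C^o -> C^o) z 1.

Definition holomorphic_monomials S : Prop :=
  forall d : nat, entire (fun z => S 1 z (fun nu => nu ^+ d)).

Definition right_shift_continuity_zero S : Prop :=
  forall f,
    (forall z : C, (fun n : nat => f.[z + n%:R]) @ \oo --> (0 : C)) ->
    forall x y : C,
      (fun n : nat => S x y (fun nu => f.[nu + n%:R])) @ \oo --> (0 : C).

(* "Of fixed degree" is expressed by [size (p n) = k] for all [n]; for [k = 0]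
   this is the constant sequence of zero polynomials. *)
Definition right_shift_continuity_approx S : Prop :=
  forall f (p : nat -> {poly C}) (k : nat),
    (forall n, size (p n) = k) ->
    (forall z : C,
      (fun n : nat => `|f.[z + n%:R] - (p n).[z + n%:R]|) @ \oo --> (0 : C)) ->
    forall x y : C,
      (fun n : nat => `|S x y (fun nu => f.[nu + n%:R])
                        - S x y (fun nu => (p n).[nu + n%:R])|)
        @ \oo --> (0 : C).

Definition right_shift_continuity S : Prop :=
  right_shift_continuity_zero S /\ right_shift_continuity_approx S.

Definition sum_polynomial p P : Prop :=
  P.[0] = 0 /\ forall z : C, P.[z] - P.[z - 1] = p.[z].

Definition sum_formula S p (x y : C) : Prop :=
  forall P, sum_polynomial p P ->
    S x y (fun nu => p.[nu]) = P.[y] - P.[x - 1].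

End SummationTheory.

(* Main.v *)
Require Import Defs.
From HB Require Import structures.
From mathcomp Require Import all_boot all_order all_algebra.
From mathcomp Require Import all_classical all_reals all_analysis.
From mathcomp Require Import complex ring.

(** Write [bdiff P] for the backward difference P(z) - P(z - 1).  Leading terms
    show that [bdiff] maps onto the polynomials ([bdiff_surj]), and a polynomial
    killed by it has period 1, hence is constant.  So every summand may be
    written [bdiff P], and the formula says that the sum of [bdiff P] telescopes.

    When the formula is a definition, the algebraic axioms are identities about
    P and holomorphy is that of polynomials.  For right shift continuity,
    linearity reduces the claim to a sequence of polynomials of bounded degree
    that tends to 0 pointwise: by Lagrange interpolation each sum is a fixed
    linear combination of finitely many values of the summands, so it tends to 0
    as well ([sum_cvg0]).

    Conversely, fix a summation theory and let [defect P t] be the error of the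
    formula for the sum of [bdiff P] from 1 to t; translation invariance moves
    any other sum to this one ([sum_defect]).  Continued summation and
    translation invariance give the cocycle identity
      defect P (s + t) = defect P s + defect P(. + s) t,
    while consistency gives defect P 1 = 0.  Since P(. + s) - P has smaller
    degree than P, its defect vanishes by induction on the degree, and then
    t |-> defect P t is additive ([defect_eq0]).  An additive map that vanishes
    at 1 vanishes at every rational number, which settles rational differences.
    If the sums of monomials are holomorphic, the
    additive map is moreover complex differentiable at 0.  Its difference
    quotients are constant along each sequence w / n, so it is multiplication by
    its derivative ([additive_derivable]), and vanishing at 1 forces it to be 0
    everywhere. *)

Import Order.TTheory GRing.Theory Num.Theory.
Import numFieldNormedType.Exports.
Local Open Scope classical_set_scope.
Local Open Scope ring_scope.
Set Implicit Arguments.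
Unset Strict Implicit.
Unset Printing Implicit Defensive.

(** * Backward differences of polynomials *)

Section BackwardDifference.
Context {F : numFieldType}.
Implicit Types (p q P Q : {poly F}) (c t z : F).

Definition shiftp c p := p \Po ('X + c%:P).

Definition bdiff P := P - shiftp (-1) P.

Lemma horner_shiftp c p z : (shiftp c p).[z] = p.[z + c].
Proof. by rewrite horner_comp hornerD hornerX hornerC. Qed.

Lemma horner_bdiff P z : (bdiff P).[z] = P.[z] - P.[z - 1].
Proof. by rewrite hornerD hornerN horner_shiftp. Qed.

(** Characteristic 0 makes the natural numbers infinitely many roots. *)
Lemma poly_eq0_nat p : (forall n : nat, p.[n%:R] = 0) -> p = 0.
Proof.
move=> p0; pose rs := [seq n%:R : F | n <- iota 0 (size p)].
apply: (@roots_geq_poly_eq0 _ _ rs); last by rewrite size_map size_iota.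
  by apply/allP => _ /mapP[n _ ->]; rewrite /root p0.
by rewrite map_inj_uniq ?iota_uniq// => m n /eqP; rewrite eqr_nat => /eqP.
Qed.

Lemma horner_inj p q : (forall z, p.[z] = q.[z]) -> p = q.
Proof.
move=> pq; apply/eqP; rewrite -subr_eq0; apply/eqP/poly_eq0_nat => n.
by rewrite hornerD hornerN pq subrr.
Qed.

Lemma bdiff_linear a b P Q :
  bdiff (a *: P + b *: Q) = a *: bdiff P + b *: bdiff Q.
Proof. by apply: horner_inj => z; rewrite !(horner_bdiff, hornerE); ring. Qed.

Lemma bdiff_shiftp c P : bdiff (shiftp c P) = shiftp c (bdiff P).
Proof.
apply: horner_inj => z; rewrite !(horner_bdiff, horner_shiftp).
by rewrite addrAC.
Qed.

(** Vanishing propagates from 0 to all natural numbers, because P takes the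
    same value at n + 1 and at n. *)
Lemma bdiff_eq0 P : bdiff P = 0 -> P.[0] = 0 -> P = 0.
Proof.
move=> dP P0; apply: poly_eq0_nat; elim=> [//|n IHn].
have := horner_bdiff P n.+1%:R; rewrite dP horner0 -natr1 addrK IHn subr0.
by move=> <-.
Qed.

(** A translation preserves the leading term, which therefore cancels. *)
Lemma size_shiftp_sub c n P :
  (size P <= n.+1)%N -> (size (shiftp c P - P)%R <= n)%N.
Proof.
move=> sP; have sX : size ('X + c%:P) = 2%N by rewrite size_XaddC.
have sQ : size (shiftp c P) = size P by rewrite size_comp_poly2.
apply/leq_sizeP => j; rewrite leq_eqVlt => /predU1P[<-|nj].
  rewrite coefB; apply/eqP; rewrite subr_eq0; apply/eqP.
  have [sPn|] := ltnP n (size P); last by move=> h; rewrite !nth_default ?sQ.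
  have {sP sPn} sPn : size P = n.+1 by apply/eqP; rewrite eqn_leq sP.
  have := @lead_coef_comp _ P ('X + c%:P); rewrite sX => /(_ isT).
  rewrite {1 2}/lead_coef sQ sPn /= => ->.
  by rewrite -[c]opprK polyCN lead_coefXsubC expr1n mulr1.
by rewrite coefB !nth_default ?subrr ?sQ// (leq_trans sP).
Qed.

(** The factorization of X^(n+1) - (X - 1)^(n+1) has first factor 1, and its
    second factor is a sum of n + 1 monic polynomials of degree n. *)
Lemma coef_bdiffXn n : (bdiff 'X^(n.+1))`_n = n.+1%:R.
Proof.
rewrite /bdiff /shiftp comp_Xn_poly subrXX opprD addNKr polyCN opprK mul1r.
rewrite coef_sum (eq_bigr (fun=> 1)) ?sumr_const ?card_ord// => i _.
set q := _ * _; have mq : q \is monic.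
  by rewrite monicMl ?monic_exp ?monicX// monicXsubC.
suff sq : size q = n.+1 by have /monicP := mq; rewrite /lead_coef sq.
rewrite size_monicM ?monic_exp ?monicX//; last first.
  by rewrite monic_neq0// monic_exp// monicXsubC.
by rewrite size_polyXn size_exp_XsubC addSn addnS /= subnK// -ltnS.
Qed.

(** Induction on the degree: subtracting a multiple of [bdiff 'X^(n.+1)]
    cancels the term of degree n of p. *)
Lemma bdiff_surj p : exists P, P.[0] = 0 /\ bdiff P = p.
Proof.
have [n] := ubnP (size p); elim: n p => // n IHn p; rewrite ltnS => sp.
case: n => [|n] in IHn sp *.
  exists 0; rewrite horner0; split=> //; apply/horner_inj => z.
  move: sp; rewrite leqn0 size_poly_eq0 => /eqP->.
  by rewrite horner_bdiff !horner0 subr0.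
pose a := p`_n / n.+1%:R.
have [|Q [Q0 dQ]] := IHn (p - a *: bdiff 'X^(n.+1)).
  rewrite ltnS; apply/leq_sizeP => j; rewrite leq_eqVlt => /predU1P[<-|nj].
    by rewrite coefB coefZ coef_bdiffXn divfK ?subrr// pnatr_eq0.
  rewrite coefB coefZ [p`_j]nth_default ?(leq_trans sp)// sub0r.
  rewrite [X in _ * X]nth_default ?mulr0 ?oppr0//; apply: leq_trans nj.
  rewrite /bdiff -opprB size_polyN; apply: size_shiftp_sub.
  by rewrite size_polyXn.
exists (1 *: Q + a *: 'X^(n.+1)); split.
  by rewrite !hornerE Q0 expr0n/= !mulr0 addr0.
by rewrite bdiff_linear dQ scale1r subrK.
Qed.
End BackwardDifference.

(** * Complex differentiability of additive maps and polynomials *)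

Section ComplexAnalysis.
Context {R : realType}.
Local Notation C := (CC R).

(** An element of the complex field above 0 is real in its partial order, so
    the Archimedean property of the real part applies. *)
Lemma complex_archi (x : C) : 0 <= x -> exists N : nat, x < N%:R.
Proof.
move=> x0; exists (Num.bound (complex.Re x)).
have /RRe_real <- : x \is Num.real by exact: ger0_real.
rewrite -(rmorph_nat (real_complex R)) ltcR archi_boundP//.
by move: x0; rewrite lecE => /andP[].
Qed.

Lemma cvg_div_nat (u : C) : u != 0 ->
  (fun n : nat => u / n.+1%:R) @ \oo --> (0 : C)^'.
Proof.
move=> u0; have un0 n : u / n.+1%:R != 0 by rewrite mulf_neq0// invr_eq0 pnatr_eq0.
have : (fun n : nat => u / n.+1%:R) @ \oo --> (0 : C).
  apply/cvgr0Pnorm_lt => e e0.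
  have [|N uN] := @complex_archi (`|u| / e); first by rewrite divr_ge0// ltW.
  exists N => // n /= Nn; rewrite normf_div normr_nat ltr_pdivrMr ?ltr0n//.
  rewrite mulrC -ltr_pdivrMr// (lt_le_trans uN)// ler_nat.
  exact: leq_trans Nn _.
move=> cu A /cu [N _ NA]; exists N => // n /NA; apply; exact: un0.
Qed.

(** By additivity the difference quotient of g at 0 with step u / (n + 1) is
    g u / u for every n; as the step tends to 0, this constant must be the
    derivative, whatever the direction of u. *)
Lemma additive_derivable (g : {additive C -> C}) :
  derivable (g : C^o -> C^o) 0 1 -> forall w, g w = w * g 1.
Proof.
rewrite /derivable; set q := (fun h : C => _) => /cvg_ex[l ql] w.
suff slope u : u != 0 -> g u / u = l.
  have [->|w0] := eqVneq w 0; first by rewrite raddf0 mul0r.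
  have := slope _ (oner_neq0 _); rewrite divr1 => ->.
  by rewrite -(slope _ w0) mulrC divfK.
move=> u0; have := cvg_comp _ _ (cvg_div_nat u0) ql.
have -> : q \o (fun n : nat => u / n.+1%:R) = fun=> g u / u.
  apply/funext => n; rewrite /q /= [_ *: 1]mulr1 addr0 raddf0 subr0.
  have -> : g u = g (u / n.+1%:R) * n.+1%:R.
    by rewrite mulr_natr -raddfMn -[_ / _ *+ _]mulr_natr divfK// pnatr_eq0.
  by rewrite [LHS]mulrC invf_div mulrA.
move=> cl; apply: (@cvg_unique C^o (@norm_hausdorff _ _) _ _ _ _ _ cl).
exact: cvg_cst.
Qed.

Lemma entire_lincomb n (c : 'I_n -> C) (f : 'I_n -> C -> C) :
  (forall i, entire (f i)) -> entire (fun z => \sum_(i < n) c i * f i z).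
Proof.
move=> fP z; rewrite -(fct_sumE _ _ (fun i z => c i * f i z)).
apply: (@derivable_sum C C^o C^o) => i; exact: (derivableZ (fP i z)).
Qed.

Lemma entire_horner (p : {poly C}) : entire (horner p).
Proof.
have -> : horner p = fun z => \sum_(i < size p) p`_i * z ^+ i.
  by apply/funext => z; rewrite horner_coef.
apply: entire_lincomb => i z; exact: (@exprn_derivable C).
Qed.
End ComplexAnalysis.

(** * Summation of polynomials *)

Section SummationTheories.
Context {R : realType}.
Local Notation C := (CC R).
Implicit Types (S : summation R) (f g p P : {poly C}) (x y z s t : C).

(** The formula is assumed for normalized P only; it extends to all P because a
    constant term changes neither [bdiff P] nor the right-hand side. *)
Lemma sum_formula_bdiff S :
  (forall p x y, sum_formula S p x y) ->
  forall P x y, S x y (horner (bdiff P)) = P.[y] - P.[x - 1].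
Proof.
move=> SP P x y; rewrite (SP (bdiff P) x y (P - P.[0]%:P)).
  by rewrite !hornerE opprB addrA subrK.
split=> [|z]; first by rewrite !hornerE subrr.
by rewrite horner_bdiff !hornerE opprB addrA subrK.
Qed.

Lemma sum_polynomialP p P : sum_polynomial p P <-> P.[0] = 0 /\ bdiff P = p.
Proof.
split=> -[P0 dP]; split=> //.
  by apply: horner_inj => z; rewrite horner_bdiff dP.
by move=> z; rewrite -dP horner_bdiff.
Qed.

Section Linear.
Context {S : summation R} (S3 : sum_linearity S).

Lemma sum_lin f g (a b x y : C) :
  S x y (horner (a *: f + b *: g)) = a * S x y (horner f) + b * S x y (horner g).
Proof.
rewrite -S3; congr (S x y _); apply/funext => z.
by rewrite !hornerE.
Qed.

Lemma sum0 x y : S x y (horner 0) = 0.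
Proof. by have := sum_lin 0 0 0 0 x y; rewrite scale0r !mul0r !addr0. Qed.

Lemma sum_lincomb n (c : 'I_n -> C) (f : 'I_n -> {poly C}) x y :
  S x y (horner (\sum_(i < n) c i *: f i)) =
  \sum_(i < n) c i * S x y (horner (f i)).
Proof.
apply: (big_ind2 (fun q v => S x y (horner q) = v)) => [||i _]; first exact: sum0.
  move=> p a q b <- <-; have := sum_lin p q 1 1 x y.
  by rewrite !scale1r !mul1r.
by have := sum_lin (f i) 0 (c i) 0 x y; rewrite scaler0 !addr0 mul0r addr0.
Qed.

(** Polynomials of size at most m are determined linearly by their values at
    the first natural numbers, so the sum over r n is a combination of finitely
    many values of r n, with coefficients independent of n. *)
Lemma sum_cvg0 m (r : nat -> {poly C}) x y :
  (forall n, size (r n) <= m)%N ->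
  (forall z, (fun n => (r n).[z]) @ \oo --> (0 : C)) ->
  (fun n => S x y (horner (r n))) @ \oo --> (0 : C).
Proof.
move=> sr r0; pose e (i : nat) : C := i%:R.
have e_inj : injective e by move=> i j /eqP; rewrite eqr_nat => /eqP.
pose L := tnth (m.+1.-lagrange e).
(* m + 1 nodes, because Lagrange interpolation needs at least one. *)
have -> : (fun n => S x y (horner (r n))) =
    fun n => \sum_(i < m.+1) (r n).[e i] * S x y (horner (L i)).
  apply/funext => n; rewrite -sum_lincomb; congr (S x y (horner _)).
  rewrite {1}(lagrange_gen (ltn0Sn m) e_inj (leqW (sr n))).
  by apply: eq_bigr => i _; rewrite mul_polyC.
have := @cvg_big C^o _ +%R 0 xpredT (@add_continuous C^o) _ \oo
  (index_enum 'I_m.+1) (fun (i : 'I_m.+1) n => (r n).[e i] * S x y (horner (L i)))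
  (fun i => 0 * S x y (horner (L i))) _.
rewrite [X in _ --> X]big1 => [|i _]; last exact: mul0r.
apply=> i _; exact: cvgMr_tmp (r0 _).
Qed.
End Linear.

(** * The defect of a summation theory *)

Section Defect.
Context {S : summation R}.
Hypotheses (S1 : continued_summation S) (S2 : translation_invariance S).
Hypotheses (S3 : sum_linearity S) (S4 : classical_consistency S).

Lemma sum_shift p x y s :
  S (x + s) (y + s) (horner p) = S x y (horner (shiftp s p)).
Proof.
by rewrite S2; congr (S x y _); apply/funext => z; rewrite horner_shiftp.
Qed.

Definition defect P t := S 1 t (horner (bdiff P)) - (P.[t] - P.[0]).

Lemma defectD P Q t : defect (P + Q) t = defect P t + defect Q t.
Proof.
have := bdiff_linear 1 1 P Q; rewrite !scale1r /defect => ->.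
have := sum_lin S3 (bdiff P) (bdiff Q) 1 1 1 t; rewrite !scale1r !mul1r => ->.
by rewrite !hornerD; ring.
Qed.

Lemma defect0 t : defect 0 t = 0.
Proof. by apply: (@addrI _ (defect 0 t)); rewrite -defectD !addr0. Qed.

Lemma defect_at1 P : defect P 1 = 0.
Proof. by rewrite /defect S4 horner_bdiff subrr subrr. Qed.

(** Split the sum from 1 to s + t at s and translate its second part back by
    s, so that it starts at 1 again. *)
Lemma defect_cocycle P s t :
  defect P (s + t) = defect P s + defect (shiftp s P) t.
Proof.
rewrite /defect -(S1 _ _ s) bdiff_shiftp -sum_shift !horner_shiftp add0r.
by rewrite [1 + s]addrC [t + s]addrC; ring.
Qed.

Lemma sum_defect P x y : S x y (horner (bdiff P)) =
  P.[y] - P.[x - 1] + defect (shiftp (x - 1) P) (y - x + 1).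
Proof.
rewrite /defect bdiff_shiftp -sum_shift !horner_shiftp.
have -> : 1 + (x - 1) = x by ring.
have -> : y - x + 1 + (x - 1) = y by ring.
by rewrite add0r; ring.
Qed.

(** The set T collects the endpoints under consideration (the rationals, or
    everything); the second hypothesis isolates the only place where a
    regularity property of T or of the summation theory enters.  The correction
    term of the cocycle is the defect of P(. + s) - P, which vanishes by
    induction on the degree. *)
Lemma defect_eq0 (T : set C) :
  (forall s t, T s -> T t -> T (s + t)) ->
  (forall P,
    (forall s t, T s -> T t -> defect P (s + t) = defect P s + defect P t) ->
    forall t, T t -> defect P t = 0) ->
  forall P t, T t -> defect P t = 0.
Proof.
move=> TD Tadd P; have [n] := ubnP (size P).
elim: n P => // n IHn P; rewrite ltnS => sP; apply: Tadd => s t Ts Tt.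
rewrite defect_cocycle; congr (_ + _).
rewrite -[shiftp s P](subrK P) defectD.
case: n IHn sP => [_|n IHn sP].
  rewrite leqn0 size_poly_eq0 => /eqP ->.
  by rewrite /shiftp comp_poly0 subr0 defect0 add0r.
by rewrite IHn ?add0r// ltnS; exact: size_shiftp_sub.
Qed.

(** Multiplying an additive map at q by the denominator of q gives its value
    at the numerator, a multiple of the value at 1. *)
Lemma defect_rat P (q : rat) : defect P (ratr q) = 0.
Proof.
apply: (@defect_eq0 (range ratr)) => [_ _ [a _ <-] [b _ <-]|{P q}P Padd|].
- by exists (a + b) => //; rewrite rmorphD.
- pose g (a : rat) := defect P (ratr a).
  have gD a b : g (a + b) = g a + g b.
    by rewrite /g rmorphD Padd//; apply: imageT.
  have gB a b : g (a - b) = g a - g b by apply: (addIr (g b)); rewrite -gD !subrK.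
  pose gH := GRing.isZmodMorphism.Build _ _ g gB.
  pose g' : {additive rat -> C} := HB.pack g gH.
  move=> _ [q _ <-]; apply/eqP; rewrite -/(g' q).
  have : (g' q) *~ denq q == 0.
    rewrite -raddfMz -mulrzr -numqE raddfMz /= /g rmorph1 defect_at1 mul0rz.
    by [].
  by rewrite mulrz_eq0 denq_eq0.
- by exists q.
Qed.

Lemma defect_entire P : holomorphic_monomials S -> entire (defect P).
Proof.
move=> S5 z; apply: (@derivableB C C^o C^o).
  have -> : (fun t => S 1 t (horner (bdiff P))) =
      fun t => \sum_(i < size (bdiff P)) (bdiff P)`_i * S 1 t (horner 'X^i).
    apply/funext => t; rewrite -sum_lincomb//; congr (S 1 t (horner _)).
    by rewrite -[LHS]coefK poly_def.
  apply: entire_lincomb => i.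
  have -> : horner 'X^i = (fun nu : C => nu ^+ i).
    by apply/funext => nu; rewrite hornerXn.
  exact: S5.
apply: (@derivableB C C^o C^o); first exact: entire_horner.
exact: derivable_cst.
Qed.

(** An additive map that is complex differentiable is multiplication by its
    value at 1, and the defect vanishes there. *)
Lemma defect_holomorphic P t : holomorphic_monomials S -> defect P t = 0.
Proof.
move=> S5; apply: (@defect_eq0 setT) => // {t}{}P Padd t _.
have gB s u : defect P (s - u) = defect P s - defect P u.
  by apply: (addIr (defect P u)); rewrite -Padd// !subrK.
pose gH := GRing.isZmodMorphism.Build _ _ (defect P) gB.
pose g : {additive C -> C} := HB.pack (defect P) gH.
have := @additive_derivable _ g (@defect_entire P S5 0) t.
by rewrite /= defect_at1 mulr0.
Qed.
End Defect.
End SummationTheories.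

(** * The characterization of polynomial summation *)

Theorem proposition1p1 (R : realType) :
  (forall p : {poly CC R}, exists! P : {poly CC R}, sum_polynomial p P) /\
  (forall S : summation R,
    (forall (p : {poly CC R}) (x y : CC R), sum_formula S p x y) ->
    continued_summation S /\ translation_invariance S /\ sum_linearity S /\
    classical_consistency S /\ holomorphic_monomials S /\
    right_shift_continuity S) /\
  (forall S : summation R,
    continued_summation S -> translation_invariance S ->
    sum_linearity S -> classical_consistency S ->
    forall (p : {poly CC R}) (x y : CC R),
      (exists q : rat, y - x = ratr q) -> sum_formula S p x y) /\
  (forall S : summation R,
    continued_summation S -> translation_invariance S ->
    sum_linearity S -> classical_consistency S -> holomorphic_monomials S ->
    forall (p : {poly CC R}) (x y : CC R), sum_formula S p x y).
Proof.
split; [|split; [|split]].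
- move=> p; have [P [P0 dP]] := bdiff_surj p.
  exists P; split=> [|Q /sum_polynomialP[Q0 dQ]]; first exact/sum_polynomialP.
  apply/eqP; rewrite -subr_eq0; apply/eqP/bdiff_eq0.
    have := bdiff_linear 1 (-1) P Q.
    by rewrite !scaleN1r !scale1r dP dQ subrr.
  by rewrite !hornerE P0 Q0 subrr.
- move=> S /sum_formula_bdiff SE.
  have S3 : sum_linearity S.
    move=> f g a b x y; have [F [_ <-]] := bdiff_surj f.
    have [G [_ <-]] := bdiff_surj g.
    have -> : (fun nu => a * (bdiff F).[nu] + b * (bdiff G).[nu]) =
              horner (bdiff (a *: F + b *: G)).
      by apply/funext => z; rewrite bdiff_linear !hornerE.
    by rewrite !SE !(hornerD, hornerZ); ring.
  have S2 : translation_invariance S.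
    move=> f x y s; have [F [_ <-]] := bdiff_surj f.
    have -> : (fun nu => (bdiff F).[nu + s]) = horner (bdiff (shiftp s F)).
      by apply/funext => z; rewrite bdiff_shiftp horner_shiftp.
    by rewrite !SE !horner_shiftp addrAC.
  (* The difference of the two shifted sums is the sum of one polynomial r n
     of bounded degree, which tends to 0 pointwise. *)
  have S6 : right_shift_continuity_approx S.
    move=> f p k sp fp x y; apply/norm_cvg0P.
    pose r n := shiftp n%:R (f - p n).
    have -> : (fun n : nat => S x y (fun nu => f.[nu + n%:R]) -
        S x y (fun nu => (p n).[nu + n%:R])) = fun n => S x y (horner (r n)).
      apply/funext => n; rewrite -!S2 -(sum_shift S2).
      have := sum_lin S3 f (p n) 1 (-1) (x + n%:R) (y + n%:R).
      by rewrite scale1r scaleN1r mul1r mulN1r.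
    apply: (@sum_cvg0 _ S S3 (maxn (size f) k)) => [n|z].
      rewrite size_comp_poly2 ?size_XaddC//.
      by rewrite (leq_trans (size_polyD _ _))// size_polyN sp.
    apply/norm_cvg0P; have -> : (fun n => `|(r n).[z]|) =
        (fun n : nat => `|f.[z + n%:R] - (p n).[z + n%:R]|).
      by apply/funext => n; rewrite horner_shiftp !hornerE.
    exact: fp.
  split=> [f x y z|].
    have [F [_ <-]] := bdiff_surj f; rewrite !SE addrK; ring.
  split=> //; split=> //; split=> [f|].
    by have [F [_ <-]] := bdiff_surj f; rewrite SE horner_bdiff.
  split=> [d|].
    have [F [_ dF]] := bdiff_surj ('X^d : {poly CC R}).
    have -> : (fun z => S 1 z (fun nu => nu ^+ d)) = horner (F - F.[0]%:P).
      apply/funext => z.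
      have -> : (fun nu : CC R => nu ^+ d) = horner (bdiff F).
        by apply/funext => nu; rewrite dF hornerXn.
      by rewrite SE subrr !hornerE.
    exact: entire_horner.
  (* The first form of the axiom is approximation by the zero polynomials. *)
  split=> // f f0 x y.
  have := S6 f (fun=> 0) 0%N (fun=> size_poly0 _).
  have fE z : (fun n : nat => `|f.[z + n%:R] - (0 : {poly CC R}).[z + n%:R]|) =
              (fun n : nat => `|f.[z + n%:R]|).
    by apply/funext => n; rewrite horner0 subr0.
  move=> /(_ _ x y) S6f; apply/norm_cvg0P.
  have SfE : (fun n : nat => `|S x y (fun nu => f.[nu + n%:R]) -
      S x y (fun nu => (0 : {poly CC R}).[nu + n%:R])|) =
      (fun n : nat => `|S x y (fun nu => f.[nu + n%:R])|).
    by apply/funext => n; rewrite -[X in _ - X]S2 sum0// subr0.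
  rewrite -SfE; apply: S6f => z; rewrite fE; apply/norm_cvg0P; exact: f0.
- move=> S S1 S2 S3 S4 p x y [q yx] P /sum_polynomialP[_ <-].
  have := defect_rat S1 S2 S3 S4 (shiftp (x - 1) P) (q + 1).
  rewrite rmorphD rmorph1 /= -yx => d0.
  by rewrite (sum_defect S2) d0 addr0.
- move=> S S1 S2 S3 S4 S5 p x y P /sum_polynomialP[_ <-].
  by rewrite (sum_defect S2) (defect_holomorphic S1 S2 S3 S4 _ _ S5) addr0.
Qed.
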